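(* Let $K_{r,1,\dots,1,s}$ be the complete multi-level poset with $l+2$ levels, in which the bottom level has $r$ elements, the top level has $s$ elements and each of the $l\ge 1$ intermediate levels has one element. The value of $La(n,P_{l+3},K_{r,1,\dots,1,s})$ is attained for a family $\mathcal{F}=\bigcup_{j=1}^{l+2}\binom{[n]}{i_j}$, where $i_1=\lfloor i_2/2\rfloor$, $i_{l+2}=\lfloor (n+i_{l+1})/2\rfloor$, and $i_3-i_2,\ i_4-i_3,\ \dots,\ i_{l+1}-i_l$ differ by at most $1$.
   Context: $[n]=\{1,\dots,n\}$, $2^{[n]}$ is the family of all subsets of $[n]$, and $\binom{[n]}{k}$ is the family of all $k$-element subsets of $[n]$. For a finite poset $P$ and a family $\mathcal{F}$ of sets, a subfamily $\mathcal{G}\subseteq\mathcal{F}$ is a copy of $P$ in $\mathcal{F}$ if there is a bijection $\phi:P\to\mathcal{G}$ such that $x\le_Px'$ implies $\phi(x)\subseteq\phi(x')$ (the converse is not required). $c(P,\mathcal{F})$ is the number of copies of $P$ in $\mathcal{F}$. $La(n,P,Q)=\max\{c(Q,\mathcal{F}):\mathcal{F}\subseteq 2^{[n]},\ c(P,\mathcal{F})=0\}$; this value is attained for $\mathcal{F}$ if $c(P,\mathcal{F})=0$ and $c(Q,\mathcal{F})=La(n,P,Q)$. $P_k$ is the chain on $k$ elements. The complete multi-level poset $K_{r_1,\dots,r_t}$ has $\sum_{i=1}^tr_i$ elements $a^i_h$ ($1\le i\le t$, $1\le h\le r_i$) with $a^i_h<a^j_m$ if and only if $i<j$.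
   Formalization: For s=1 the claim fails for some small n (e.g. l=r=s=1, n=2); so for s=1 and n below some threshold depending on l and r, the choice i_{l+1}=n-1, i_{l+2}=n is also allowed. For s≥2 the claim is proved for every n, for s=1 for all n from the threshold on. *)

(* Defs.v *)
From HB Require Import structures.
From mathcomp Require Import all_boot all_order.

Set Implicit Arguments.
Unset Strict Implicit.
Unset Printing Implicit Defensive.

(* The ground set [n] is 'I_n, so that 2^[n] is {set 'I_n}. *)
Section Copies.
Variable n : nat.

(* Only x <= y -> phi x \subset phi y is required, not the converse. *)
Definition is_copy (d : Order.disp_t) (P : finPOrderType d)
    (G : {set {set 'I_n}}) : bool :=
  [exists phi : {ffun P -> {set 'I_n}},
    [&& injectiveb phi, G == [set phi x | x : P] &
        [forall x, forall y, (x <= y)%O ==> (phi x \subset phi y)]]].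

(* Copies are subfamilies, each counted once however many maps phi realize it. *)
Definition copies (d : Order.disp_t) (P : finPOrderType d)
    (F : {set {set 'I_n}}) : nat :=
  #|[set G : {set {set 'I_n}} | (G \subset F) && is_copy P G]|.

Definition layer (k : nat) : {set {set 'I_n}} := [set A : {set 'I_n} | #|A| == k].

End Copies.

Definition La (n : nat) (d d' : Order.disp_t)
    (P : finPOrderType d) (Q : finPOrderType d') : nat :=
  \max_(F : {set {set 'I_n}} | copies P F == 0) copies Q F.

Definition La_attained (n : nat) (d d' : Order.disp_t)
    (P : finPOrderType d) (Q : finPOrderType d') (F : {set {set 'I_n}}) : Prop :=
  copies P F = 0 /\ copies Q F = La n P Q.

(* multilevel [:: r_1; ...; r_t] is K_{r_1,...,r_t}: the element a^i_h is the
   pair of its level i and its position h, both counted from 0. *)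
Definition multilevel (rs : seq nat) : Type :=
  {i : 'I_(size rs) & 'I_(nth 0 rs i)}.

Section MultilevelOrder.
Variable rs : seq nat.

HB.instance Definition _ := Finite.on (multilevel rs).

Definition multilevel_lt (x y : multilevel rs) : bool := tag x < tag y.

Fact multilevel_lt_irr : irreflexive multilevel_lt.
Proof. by move=> x; rewrite /multilevel_lt ltnn. Qed.

Fact multilevel_lt_trans : transitive multilevel_lt.
Proof. by move=> y x z; apply: ltn_trans. Qed.

Fact multilevel_display : Order.disp_t.
Proof. exact: Order.Disp tt tt. Qed.

HB.instance Definition _ :=
  Order.Lt_isPOrder.Build multilevel_display (multilevel rs)
    multilevel_lt_irr multilevel_lt_trans.

End MultilevelOrder.

(* K_{r,1,...,1,s} with l intermediate levels. *)
Notation K_r1s r l s := (multilevel (r :: rcons (nseq l 1) s)).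

(* P_k, with the usual order of 'I_k. *)
Notation chain k := 'I_k.

(* Main.v *)
(* A copy of K_{r,1,...,1,s} in a P_{l+3}-free family F consists of a chain
   M_1 < ... < M_l in F, r members of F below M_1 and s members above M_l. The
   members of F below M_1 form an antichain, and so do those above M_l, hence
   Sperner's theorem bounds the number of ways to extend the chain by a quantity
   w(m_1, n - m_l) that depends only on the sizes m_j of the M_j. A maximal chain of
   2^[n] passes through at most one extendable chain (M_1, ..., M_l), since two of
   them could be spliced into a chain of l+3 members of F; so, as in the LYM
   inequality, the number of copies is at most the maximum of N * w, where N is the
   number of chains of subsets of [n] with sizes m_1 < ... < m_l. The family of
   complete levels of these sizes, with the two outer levels in the middle,
   reaches N * w. Moving one element between two of the differences
   m_1, m_2 - m_1, ..., n - m_l multiplies N by a quotient of two sizes, which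
   forces the inner differences to be balanced at a maximum. *)
Require Import Defs.
From mathcomp Require Import all_boot all_order.
From mathcomp Require Import perm zify.

Set Implicit Arguments.
Unset Strict Implicit.
Unset Printing Implicit Defensive.

(* A coloring [f] encodes the chain [below f 0, ..., below f l.-1] of subsets of
   the ground set; the differences of consecutive sizes are the fiber sizes. *)
Definition coloring n l := {ffun 'I_n -> 'I_l.+1}.

(** * Colorings of a given type, orders sorting them, and the LYM inequality *)

Section Colorings.
Variables n l : nat.
Implicit Types (f g : coloring n l) (a b : 'I_l.+1) (s p : {perm 'I_n}).

Definition fiber f a : {set 'I_n} := [set x | f x == a].

Definition below f (j : nat) : {set 'I_n} := [set x | f x <= j].

Definition same_type f g := [forall a, #|fiber f a| == #|fiber g a|].

Definition type_count f := #|[set g | same_type f g]|.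

(* Read as a linear order on the ground set, [s] lists every [below f j] as an
   initial segment. *)
Definition sorts s f :=
  [forall x : 'I_n, forall y : 'I_n, (x <= y) ==> (f (s x) <= f (s y))].

Lemma same_typeP f g : reflect (forall a, #|fiber f a| = #|fiber g a|) (same_type f g).
Proof. by apply: (iffP forallP) => h a; apply/eqP; rewrite h. Qed.

Lemma sortsP s f :
  reflect (forall x y : 'I_n, x <= y -> f (s x) <= f (s y)) (sorts s f).
Proof.
apply: (iffP forallP) => [h x y xy|h x]; first by move/forallP/(_ y)/implyP: (h x); apply.
by apply/forallP => y; apply/implyP; apply: h.
Qed.

Lemma count_fiber f a : count_mem a [tuple f x | x < n] = #|fiber f a|.
Proof.
rewrite /= count_map -size_filter cardE /fiber enumT; congr size.
by rewrite /enum_mem -enumT; apply: eq_filter => x; rewrite !inE.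
Qed.

(** Equal fiber sizes make the two tuples of colors permutations of each other. *)
Lemma same_type_perm f g : same_type f g -> exists p, forall x, f x = g (p x).
Proof.
move=> /same_typeP fg.
have /tuple_permP[p hp] : perm_eq [tuple f x | x < n] [tuple g x | x < n].
  apply/allP => a _; have := count_fiber g a; have := count_fiber f a.
  by rewrite fg => /= -> ->.
exists p => x; have /(congr1 (fun t => tnth t x)) := val_inj hp.
by rewrite !tnth_mktuple.
Qed.

Lemma sorts_ex f : exists s, sorts s f.
Proof.
pose r (a b : 'I_l.+1) := a <= b.
pose t := [tuple f x | x < n].
have rtot : total r by move=> a b; apply: leq_total.
have rtr : transitive r by move=> a b c; apply: leq_trans.
have /tuple_permP[p hp] : perm_eq (sort_tuple r t) t by rewrite perm_sort.
exists p; apply/sortsP => x y xy.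
have st : sorted r (sort_tuple r t) by apply: sort_sorted.
have e z : tnth (sort_tuple r t) z = f (p z).
  by rewrite (val_inj hp) !tnth_mktuple.
rewrite -!e !(tnth_nth ord0); apply: (sorted_leq_nth rtr _ _ st) => //.
- by rewrite inE size_tuple ltn_ord.
- by rewrite inE size_tuple ltn_ord.
Qed.

(** Both sets are initial segments of the one order [s]. *)
Lemma below_total f g s j k : sorts s f -> sorts s g ->
  (below f j \subset below g k) || (below g k \subset below f j).
Proof.
move=> /sortsP sf /sortsP sg; apply/orP.
case: (boolP (_ \subset _)) => [|/subsetPn[x]]; first by left.
rewrite !inE -ltnNge => fx gx; right; apply/subsetP => y; rewrite !inE => gy.
case: (leqP (s^-1%g x) (s^-1%g y)) => [xy|/ltnW yx].
  by have := sg _ _ xy; rewrite !permKV; lia.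
by have := sf _ _ yx; rewrite !permKV; lia.
Qed.

Definition relabel p f : coloring n l := [ffun x => f (p x)].

Lemma fiber_relabel p f a : #|fiber (relabel p f) a| = #|fiber f a|.
Proof.
rewrite -(card_imset (fiber f a) (@perm_inj _ p^-1%g)); apply: eq_card => x.
apply/idP/imsetP => [|[y]]; rewrite !inE ?ffunE => h.
  by exists (p x); rewrite ?inE ?permK.
by move=> ->; rewrite permKV.
Qed.

(** A permutation carrying [f] to [g] acts injectively on orders by right multiplication. *)
Lemma card_sorts f g : same_type f g ->
  #|[set s | sorts s f]| <= #|[set s | sorts s g]|.
Proof.
case/same_type_perm => p fg.
rewrite -(card_imset _ (@mulIg _ p)); apply: subset_leq_card.
apply/subsetP => _ /imsetP[s + ->]; rewrite !inE => /sortsP sf; apply/sortsP => x y /sf.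
by rewrite !permM !fg.
Qed.

(** Double counting of pairs of a coloring of the type of [f] and an order sorting it: each order
    sorts at least one such coloring, and each coloring is sorted by at most as many orders as
    [f]. *)
Lemma type_count_sorts f : n`! <= type_count f * #|[set s | sorts s f]|.
Proof.
have -> : type_count f * #|[set s | sorts s f]|
        = \sum_(g in [set g | same_type f g]) #|[set s | sorts s f]|.
  by rewrite sum_nat_const.
apply: (@leq_trans (\sum_(g in [set g | same_type f g]) \sum_(s | sorts s g) 1)).
  rewrite (exchange_big_dep predT) //= -card_Sn -sum1_card.
  apply: leq_sum => s _; rewrite sum1_card; apply/card_gt0P.
  have [s0 /sortsP h0] := sorts_ex f.
  (* The color at [s x] is that of [f] at [s0 x], and [s0] sorts [f]. *)
  exists (relabel (s^-1 * s0)%g f); rewrite unfold_in /= inE; apply/andP; split.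
    by apply/same_typeP => a; rewrite fiber_relabel.
  by apply/sortsP => x y xy; rewrite !ffunE !permM !permK h0.
apply: leq_sum => g; rewrite inE => fg; rewrite sum1_card -cardsE; apply: card_sorts.
by apply/same_typeP => a; rewrite (same_typeP _ _ fg).
Qed.

(* LYM argument: for a uniformly random order [s], a coloring is sorted by
   [s] with probability at least [1 / type_count f]. *)
Lemma LYM (C : {set coloring n l}) (w : coloring n l -> nat) (B : nat) :
  (forall f g s, f \in C -> g \in C -> sorts s f -> sorts s g -> f = g) ->
  (forall f, f \in C -> type_count f * w f <= B) ->
  \sum_(f in C) w f <= B.
Proof.
move=> Cuniq CB; rewrite -(leq_pmul2l (fact_gt0 n)).
apply: (@leq_trans (\sum_(f in C) B * #|[set s | sorts s f]|)).
  rewrite big_distrr /=; apply: leq_sum => f fC.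
  apply: leq_trans (leq_mul (CB f fC) (leqnn _)).
  by rewrite mulnAC leq_mul2r type_count_sorts orbT.
rewrite -big_distrr /= mulnC leq_mul2r; apply/orP; right.
under eq_bigr => f _ do rewrite cardsE -sum1_card.
(* Summing over orders first, each order sorts at most one member of [C]. *)
rewrite (exchange_big_dep predT) //= -card_Sn -sum1_card; apply: leq_sum => s _.
rewrite sum1_card; apply/card_le1_eqP => f g /andP[fC sf] /andP[gC sg].
exact: Cuniq gC fC sg sf.
Qed.

Lemma coloring_below_inj f g : (forall j, j < l -> below f j = below g j) -> f = g.
Proof.
move=> h; apply/ffunP => x; apply/val_inj => /=.
have e j : j < l -> (f x <= j) = (g x <= j).
  by move=> /h /setP/(_ x); rewrite !inE.
have := e (f x); have := e (g x); have := ltn_ord (f x); have := ltn_ord (g x); lia.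
Qed.

Lemma chain_coloring (M : nat -> {set 'I_n}) :
  (forall j, j.+1 < l -> M j \subset M j.+1) ->
  exists f, forall j, j < l -> below f j = M j.
Proof.
(* The color of [x] is the first index of a set containing it; [find] returns [l], the last color,
   when there is none. *)
move=> sM; pose c x := find (fun j => x \in M j) (iota 0 l).
have cl x : c x < l.+1 by rewrite ltnS /c -[X in _ <= X](size_iota 0) find_size.
exists [ffun x => Ordinal (cl x)] => j jl; apply/setP => x; rewrite inE ffunE /=.
apply/idP/idP => [cj|xM].
  have cl' : c x < l by lia.
  have xc : x \in M (c x).
    have hh : has (fun j => x \in M j) (iota 0 l) by rewrite has_find size_iota.
    by have := nth_find 0 hh; rewrite nth_iota ?add0n.
  elim: j cj jl => [|j IH]; first by rewrite leqn0 => /eqP <-.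
  rewrite leq_eqVlt => /orP[/eqP<- //|cj jl].
  by apply: (subsetP (sM j jl)); apply: IH; lia.
rewrite leqNgt; apply/negP => jc.
by have := before_find 0 jc; rewrite nth_iota // xM.
Qed.

Lemma below0 f : below f 0 = fiber f ord0.
Proof. by apply/setP => x; rewrite !inE leqn0. Qed.

Lemma below_fiber f a j : a = j.+1 :> nat -> #|below f j.+1| = #|below f j| + #|fiber f a|.
Proof.
move=> aj; rewrite -cardsUI.
have -> : below f j :&: fiber f a = set0.
  by apply/setP => x; rewrite !inE -val_eqE /=; lia.
rewrite cards0 addn0; apply: eq_card => x; rewrite !inE -val_eqE /=; lia.
Qed.

Lemma card_below f a j : a = j.+1 :> nat -> l = j.+1 -> n = #|below f j| + #|fiber f a|.
Proof.
move=> aj lj; rewrite -(below_fiber f aj) -[LHS]card_ord; apply: eq_card => x; rewrite !inE.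
by have := ltn_ord (f x); lia.
Qed.

Lemma below_same f g j : same_type f g -> #|below f j| = #|below g j|.
Proof.
move=> /same_typeP fg; elim: j => [|j IH]; first by rewrite !below0 fg.
case: (ltnP j.+1 l.+1) => jl; first by rewrite !(@below_fiber _ (Ordinal jl)) // IH fg.
have e h : below h j.+1 = below h j.
  by apply/setP => x; rewrite !inE; have := ltn_ord (h x); lia.
by rewrite !e.
Qed.

Definition recolor f x b : coloring n l := [ffun y => if y == x then b else f y].

(** Adding the booleans on both sides avoids truncated subtraction and treats all colors [c] at
    once. *)
Lemma fiber_recolor f x a b c : f x = a -> a != b ->
  #|fiber (recolor f x b) c| + (c == a) = #|fiber f c| + (c == b).
Proof.
move=> fxa ab.
have fE d : #|fiber f d| = (d == a) + #|fiber f d :\ x|.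
  by rewrite (cardsD1 x) inE fxa eq_sym.
have rE d : #|fiber (recolor f x b) d| = (d == b) + #|fiber f d :\ x|.
  rewrite (cardsD1 x) inE ffunE eqxx eq_sym; congr (_ + _).
  by apply: eq_card => y; rewrite !inE ffunE; case: (eqVneq y x).
rewrite rE fE; lia.
Qed.

Lemma recolor_same f g x y a b : f x = a -> g y = a -> a != b -> same_type f g ->
  same_type (recolor f x b) (recolor g y b).
Proof.
move=> fx gy ab /same_typeP fg; apply/same_typeP => c.
have := fiber_recolor c fx ab; have := fiber_recolor c gy ab; rewrite fg; lia.
Qed.

Lemma recolorK f x a b : f x = a -> recolor (recolor f x b) x a = f.
Proof. by move=> fx; apply/ffunP => y; rewrite !ffunE; case: eqP => [->|]. Qed.

Lemma type_count_fiber f a :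
  type_count f * #|fiber f a|
  = #|[set t : coloring n l * 'I_n | same_type f t.1 && (t.1 t.2 == a)]|.
Proof.
rewrite -[RHS]sum1_card
  (eq_bigl (fun t : coloring n l * 'I_n => same_type f t.1 && (t.1 t.2 == a))).
  rewrite -(pair_big_dep (same_type f) (fun g x => g x == a) (fun _ _ => 1)) /=.
  rewrite (eq_bigr (fun=> #|fiber f a|)) => [|g fg].
    by rewrite sum_nat_const /type_count cardsE.
  by rewrite sum1_card (same_typeP _ _ fg) -cardsE.
by move=> t; rewrite inE.
Qed.

(** Giving the marked point the color [b] is injective on pairs, since giving it back the color [a]
    undoes it. *)
Lemma type_count_recolor_le f x a b : f x = a -> a != b ->
  type_count f * #|fiber f a| <= type_count (recolor f x b) * #|fiber (recolor f x b) b|.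
Proof.
move=> fx ab; rewrite !type_count_fiber.
pose h (t : coloring n l * 'I_n) := (recolor t.1 t.2 b, t.2).
rewrite -(@card_in_imset _ _ h) => [|[g y] [g' y']]; last first.
  rewrite !inE /= => /andP[_ /eqP gy] /andP[_ /eqP gy'] [e yy]; subst y'.
  by rewrite -(recolorK b gy) e recolorK.
apply: subset_leq_card; apply/subsetP => _ /imsetP[[g y] + ->].
rewrite !inE /= => /andP[fg /eqP gy]; rewrite ffunE eqxx eqxx andbT.
exact: recolor_same gy ab fg.
Qed.

(* Double counting of the pairs (coloring, element that changes color). *)
Lemma type_count_recolor f x a b : f x = a -> a != b ->
  type_count f * #|fiber f a| = type_count (recolor f x b) * #|fiber (recolor f x b) b|.
Proof.
move=> fx ab; apply/eqP; rewrite eqn_leq type_count_recolor_le //=.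
have := @type_count_recolor_le (recolor f x b) x b a; rewrite recolorK //.
by apply; rewrite ?ffunE ?eqxx // eq_sym.
Qed.

End Colorings.

(** * Central binomial coefficients *)

Definition central m := 'C(m, m %/ 2).

Lemma bin_le_central m k : 'C(m, k) <= central m.
Proof.
have inc j : j.*2 < m -> 'C(m, j) <= 'C(m, j.+1).
  move=> jm; rewrite -(leq_pmul2l (ltn0Sn j)) mul_bin_left leq_mul2r.
  by apply/orP; right; lia.
have half j i : j + i <= m %/ 2 -> 'C(m, j) <= 'C(m, j + i).
  elim: i => [|i IH] ji; first by rewrite addn0.
  apply: leq_trans (IH _) _; first by lia.
  by rewrite addnS; apply: inc; lia.
have low j : j <= m %/ 2 -> 'C(m, j) <= central m.
  by move=> jm; have := half j (m %/ 2 - j); rewrite subnKC //; apply.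
case: (leqP k (m %/ 2)) => [|mk]; first exact: low.
case: (leqP k m) => [km|mk']; last by rewrite bin_small.
by rewrite -bin_sub //; apply: low; lia.
Qed.

Lemma central_ge m : m <= central m.
Proof. by rewrite -{1}(bin1 m) bin_le_central. Qed.

Lemma centralS m : central m.+1 <= 2 * central m.
Proof.
rewrite {1}/central; case: (m.+1 %/ 2) => [|k].
  by rewrite bin0 muln_gt0 /= bin_gt0; lia.
by rewrite binS mulSn mul1n leq_add // bin_le_central.
Qed.

(** * Sperner's theorem, and its versions below and above a fixed set *)

Section Sperner.
Variable n : nat.
Implicit Types (A B M : {set 'I_n}) (F : {set {set 'I_n}}).

Definition antichain F := forall A B, A \in F -> B \in F -> ~~ (A \proper B).

(** A single set is a chain of length one, so that [LYM] applies with [l = 1]. *)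
Definition indicator A : coloring n 1 := [ffun x => if x \in A then ord0 else ord_max].

Lemma fiber_indicator A : fiber (indicator A) ord0 = A.
Proof. by apply/setP => x; rewrite inE ffunE; case: (x \in A). Qed.

Lemma type_count_indicator A : type_count (indicator A) <= central n.
Proof.
apply: leq_trans (bin_le_central n #|A|).
have -> : 'C(n, #|A|) = 'C(#|[set: 'I_n]|, #|A|) by rewrite cardsT card_ord.
rewrite -cards_draws.
have inj : injective (fun f : coloring n 1 => fiber f ord0).
  by move=> f g fg; apply: coloring_below_inj => -[|//] _; rewrite !below0.
rewrite /type_count -(card_imset _ inj); apply: subset_leq_card.
apply/subsetP => _ /imsetP[g + ->].
by rewrite !inE subsetT => /same_typeP/(_ ord0) <-; rewrite fiber_indicator eqxx.
Qed.

(** [LYM] with unit weights: two sets sorted by the same order are comparable, hence equal in an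
    antichain. *)
Lemma Sperner F : antichain F -> #|F| <= central n.
Proof.
move=> antiF.
have inj : injective indicator by move=> A B e; rewrite -(fiber_indicator A) e fiber_indicator.
rewrite -(card_imset _ inj) -sum1_card; apply: LYM => [f g s|f].
  case/imsetP => A AF -> /imsetP[B BF ->] sA sB; congr indicator.
  have := below_total 0 0 sA sB; rewrite !below0 !fiber_indicator.
  rewrite !subEproper (negbTE (antiF _ _ AF BF)) (negbTE (antiF _ _ BF AF)) !orbF.
  by case/orP => /eqP.
by case/imsetP => A _ ->; rewrite muln1 type_count_indicator.
Qed.

End Sperner.

Section SpernerSub.
Variable n : nat.
Implicit Types (A B M : {set 'I_n}) (F : {set {set 'I_n}}).

Lemma Sperner_sub M F :
  antichain F -> (forall A, A \in F -> A \subset M) -> #|F| <= central #|M|.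
Proof.
move=> antiF FM; pose h A : {set 'I_#|M|} := [set i | enum_val i \in A].
have hS A B : A \subset M -> (h A \subset h B) = (A \subset B).
  move=> /subsetP AM; apply/subsetP/subsetP => AB x; last by rewrite !inE; apply: AB.
  move=> xA; have := AB (enum_rank_in (AM x xA) x).
  by rewrite !inE enum_rankK_in ?AM //; apply.
have inj : {in F &, injective h}.
  move=> A B AF BF e; apply/eqP; rewrite eqEsubset.
  by rewrite -(hS A B) -?(hS B A) ?FM // e subxx.
rewrite -(card_in_imset inj); apply: Sperner => _ _ /imsetP[A AF ->] /imsetP[B BF ->].
by rewrite properE !hS ?FM // -properE antiF.
Qed.

Lemma Sperner_sup M F :
  antichain F -> (forall A, A \in F -> M \subset A) -> #|F| <= central #|~: M|.
Proof.
move=> antiF FM; rewrite -(card_imset _ (@setC_inj _)).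
apply: Sperner_sub => [_ _ /imsetP[A AF ->] /imsetP[B BF ->]|_ /imsetP[A AF ->]].
  by rewrite properC; apply: antiF.
by rewrite setCS FM.
Qed.

End SpernerSub.

(** * Copies of a multilevel poset, level by level *)

Section Blocks.
Variables (n : nat) (rs : seq nat).
Implicit Types (G : {set {set 'I_n}}) (B : nat -> {set {set 'I_n}}).

Definition blocks B G :=
  [/\ forall i, i < size rs -> #|B i| = nth 0 rs i,
      forall i j A A', i < j < size rs -> A \in B i -> A' \in B j -> A \proper A'
    & G = \bigcup_(i < size rs) B i].

Lemma card_level i : i < size rs -> #|[set x : multilevel rs | tag x == i :> nat]| = nth 0 rs i.
Proof.
move=> irs; pose T (j : 'I_(size rs)) := 'I_(nth 0 rs j).
pose h (k : 'I_(nth 0 rs i)) : multilevel rs := @Tagged _ (Ordinal irs) T k.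
have inj : injective h by move=> k k' /eqP; rewrite eq_Tagged => /eqP.
rewrite -[RHS]card_ord -[RHS]cardsT -(card_imset _ inj); apply: eq_card => x; rewrite inE.
apply/eqP/imsetP => [|[k _ ->] //]; case: x => j y /= e.
have ej : j = Ordinal irs by apply: val_inj.
by subst j; exists y.
Qed.

(** The blocks are the images of the levels; injectivity of the map makes its inclusions proper. *)
Lemma copy_blocks G : is_copy (multilevel rs : finPOrderType _) G -> exists B, blocks B G.
Proof.
case/existsP => phi /and3P[/injectiveP inj /eqP eG /forallP mono].
pose L i := [set x : multilevel rs | tag x == i :> nat].
exists (fun i => phi @: L i); split.
- by move=> i irs; rewrite card_imset // card_level.
- move=> i j _ _ /andP[ij jrs] /imsetP[x xi ->] /imsetP[y yj ->].
  rewrite !inE in xi yj.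
  have xy : (x < y)%O by rewrite /Order.lt /= /multilevel_lt (eqP xi) (eqP yj).
  rewrite properEneq inj_eq // (Order.POrderTheory.lt_eqF xy) /=.
  by move/forallP/(_ y)/implyP: (mono x); apply; apply: Order.POrderTheory.ltW.
apply/setP => A; rewrite eG.
apply/imsetP/bigcupP => [[x _ ->]|[i _ /imsetP[x _ ->]]]; last by exists x.
by exists (tag x) => //; apply: imset_f; rewrite inE.
Qed.

(** The element at position [h] of level [i] is sent to the set at position [h] in the enumeration
    of [B i]. *)
Lemma blocks_copy B G : blocks B G -> is_copy (multilevel rs : finPOrderType _) G.
Proof.
case=> cB pB eG; apply/existsP.
pose phi (x : multilevel rs) : {set 'I_n} := nth set0 (enum (B (tag x))) (tagged x).
have phiB x : phi x \in B (tag x).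
  by rewrite -mem_enum mem_nth // -cardE cB // ltn_ord.
have mono x y : (x < y)%O -> phi x \proper phi y.
  by move=> xy; apply: (pB (tag x) (tag y)) => //; rewrite ltn_ord andbT.
exists (finfun phi); apply/and3P; split.
- apply/injectiveP => x y; rewrite !ffunE.
  case: (ltngtP (tag x) (tag y)) => [xy e|yx e|e].
  + by have := mono x y xy; rewrite e properxx.
  + by have := mono y x yx; rewrite e properxx.
  case: x y e => i x [j y] /= /val_inj e; subst j => /eqP.
  rewrite /phi /= nth_uniq ?enum_uniq -?cardE ?cB //= => /eqP/val_inj -> //.
- rewrite eG; apply/eqP/setP => A; apply/bigcupP/imsetP => [[i _ AB]|[x _ ->]]; last first.
    by exists (tag x); rewrite ?ffunE ?phiB.
  have hA : index A (enum (B i)) < nth 0 rs i by rewrite -cB // cardE index_mem mem_enum.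
  pose T (j : 'I_(size rs)) := 'I_(nth 0 rs j).
  exists (@Tagged _ i T (Ordinal hA)) => //.
  by rewrite ffunE /phi /= nth_index ?mem_enum.
apply/forallP => x; apply/forallP => y; apply/implyP; rewrite !ffunE.
rewrite Order.POrderTheory.le_eqVlt => /orP[/eqP-> //|/mono /proper_sub //].
Qed.

End Blocks.

(** * Chains in families, and chain-freeness of unions of levels *)

Section Chains.
Variables (n : nat).
Implicit Types (F : {set {set 'I_n}}).

Lemma chain_free F k (h : nat -> {set 'I_n}) : copies (chain k) F = 0 ->
  (forall i, i < k -> h i \in F) -> (forall i, i.+1 < k -> h i \proper h i.+1) -> False.
Proof.
move=> /eqP; rewrite cards_eq0 => /eqP/setP F0 hF hp.
have mono i j : i < j -> j < k -> h i \proper h j.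
  elim: j => // j IH; rewrite ltnS leq_eqVlt => /orP[/eqP-> /hp //|ij jk].
  by apply: proper_trans (IH ij _) (hp _ jk); lia.
have := F0 [set h x | x : 'I_k]; rewrite !inE => /negbT/negP[]; apply/andP; split.
  by apply/subsetP => _ /imsetP[x _ ->]; apply: hF.
apply/existsP; exists [ffun x : 'I_k => h x]; apply/and3P; split.
- apply/injectiveP => x y; rewrite !ffunE => e; apply: val_inj => /=.
  by case: (ltngtP x y) => // /mono/(_ (ltn_ord _)); rewrite e properxx.
- by apply/eqP/eq_imset => x; rewrite ffunE.
apply/forallP => x; apply/forallP => y; apply/implyP; rewrite !ffunE Order.OrdinalOrder.leEord.
by rewrite leq_eqVlt => /orP[/eqP-> //|/mono/(_ (ltn_ord _))/proper_sub].
Qed.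

(** The members of a chain have distinct sizes, and only [k] sizes are available. *)
Lemma layers_chain_free (i : nat -> nat) k :
  copies (chain k.+1) (\bigcup_(1 <= j < k.+1) layer n (i j)) = 0.
Proof.
apply/eqP; rewrite cards_eq0; apply/eqP/setP => G; rewrite !inE; apply/negbTE/negP.
case/andP => /subsetP GF /existsP[phi /and3P[/injectiveP inj /eqP eG /forallP mono]].
have sz x : #|phi x| \in [seq i j | j <- index_iota 1 k.+1].
  have /GF : phi x \in G by rewrite eG imset_f.
  rewrite big_nat_cond; move: (index_iota _ _) => s.
  elim: s => [|a s IH] /=; first by rewrite big_nil inE.
  rewrite big_cons; case: ifP => _; last by move/IH; rewrite inE orbC => ->.
  by rewrite !inE => /orP[->|/IH ->]; rewrite ?orbT.
have un : uniq [seq #|phi x| | x : 'I_k.+1].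
  apply/injectiveP => x y e.
  have aux (a b : 'I_k.+1) : a <= b -> #|phi a| = #|phi b| -> a = b.
    move=> ab eab; apply: inj; apply/eqP; rewrite eqEcard eab leqnn andbT.
    by move/forallP/(_ b)/implyP: (mono a); apply.
  by case: (leqP x y) => [/aux|/ltnW/aux]; move=> h; [apply: h|symmetry; apply: h].
have := uniq_leq_size un (s2 := [seq i j | j <- index_iota 1 k.+1]).
rewrite size_map -cardE card_ord size_map size_iota => h.
have : k.+1 <= k.+1 - 1; last by lia.
by apply: h => _ /mapP[x _ ->]; apply: sz.
Qed.

End Chains.

(** * Extendable chains and the triples that encode copies *)

Section Copies.
Variables n l r s : nat.
Hypothesis l_gt0 : 0 < l.
Implicit Types (F G R S : {set {set 'I_n}}) (f g : coloring n l).

Definition down F f := [set A in F | A \proper below f 0].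
Definition up F f := [set A in F | below f l.-1 \proper A].

(** These are the extendable chains of [F]. *)
Definition proper_chains F : {set coloring n l} :=
  [set f | [&& [forall j : 'I_l, below f j \in F],
               [forall j : 'I_l, (j.+1 < l) ==> (below f j \proper below f j.+1)],
               down F f != set0 & up F f != set0]].

Lemma proper_chainsP F f :
  reflect [/\ forall j, j < l -> below f j \in F,
              forall j, j.+1 < l -> below f j \proper below f j.+1,
              exists A, A \in down F f & exists A, A \in up F f]
          (f \in proper_chains F).
Proof.
rewrite inE; apply: (iffP and4P) => -[h1 h2 h3 h4]; split; try exact/set0Pn.
- by move=> j jl; move/forallP/(_ (Ordinal jl)): h1.
- by move=> j jl; move/forallP/(_ (Ordinal (ltnW jl)))/implyP: h2; apply.
- by apply/forallP => j; apply: h1.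
- by apply/forallP => j; apply/implyP; apply: h2.
Qed.

Lemma below_sub f j k : j <= k -> below f j \subset below f k.
Proof. by move=> jk; apply/subsetP => x; rewrite !inE => /leq_trans; apply. Qed.

(** [D] and [U] are left abstract so that one count serves both bounds: with [down] and [up] for an
    arbitrary family, and with sets of one prescribed size for complete levels. *)
Definition triples (C : {set coloring n l}) (D U : coloring n l -> {set {set 'I_n}}) :=
  [set t : coloring n l * ({set {set 'I_n}} * {set {set 'I_n}}) |
   (t.1 \in C) && (((t.2.1 \subset D t.1) && (#|t.2.1| == r)) &&
                   ((t.2.2 \subset U t.1) && (#|t.2.2| == s)))].

Lemma card_triples C D U :
  #|triples C D U| = \sum_(f in C) 'C(#|D f|, r) * 'C(#|U f|, s).
Proof.
rewrite -sum1_card (eq_bigl (fun t => (t.1 \in C) &&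
    (t.2 \in setX [set R : {set {set 'I_n}} | R \subset D t.1 & #|R| == r]
                  [set S : {set {set 'I_n}} | S \subset U t.1 & #|S| == s])));
  last by case=> f [R S]; rewrite !inE.
rewrite -(pair_big_dep (fun f => f \in C)
  (fun f (p : {set {set 'I_n}} * {set {set 'I_n}}) =>
     p \in setX [set R : {set {set 'I_n}} | R \subset D f & #|R| == r]
                [set S : {set {set 'I_n}} | S \subset U f & #|S| == s])
  (fun _ _ => 1)) /=.
by apply: eq_bigr => f _; rewrite sum1_card cardsX !cards_draws.
Qed.

Definition members f : {set {set 'I_n}} := [set below f (j : 'I_l) | j : 'I_l].

Definition union_of (t : coloring n l * ({set {set 'I_n}} * {set {set 'I_n}})) :=
  t.2.1 :|: members t.1 :|: t.2.2.

Let rs := r :: rcons (nseq l 1) s.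

Lemma size_rs : size rs = l.+2.
Proof. by rewrite /= size_rcons size_nseq. Qed.

Lemma nth_rs i : i < l.+2 ->
  nth 0 rs i = if i == 0 then r else if i == l.+1 then s else 1.
Proof.
case: i => // i il; rewrite /= eqSS nth_rcons size_nseq.
case: ltngtP => // ; last by lia.
by move=> il'; rewrite nth_nseq il'.
Qed.

Lemma copy_triple F G : 0 < r -> 0 < s -> G \subset F -> is_copy (K_r1s r l s) G ->
  exists2 t, t \in triples (proper_chains F) (down F) (up F) & G = union_of t.
Proof.
move=> r_gt0 s_gt0 GF /copy_blocks[B]; rewrite /blocks size_rs => -[cB pB eG].
have BF i A : i < l.+2 -> A \in B i -> A \in F.
  move=> il AB; apply: (subsetP GF); rewrite eG; apply/bigcupP.
  by exists (Ordinal il).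
(* The intermediate blocks are singletons; the default [set0] is never taken for [j < l]. *)
pose M j := odflt set0 [pick A in B j.+1].
have BM j : j < l -> B j.+1 = [set M j].
  move=> jl; have /eqP/cards1P[A e] : #|B j.+1| = 1.
    by rewrite cB ?nth_rs ?ltnS //=; try lia; rewrite eqSS ltn_eqF.
  rewrite e; congr [set _]; rewrite /M e; case: pickP => [C|/(_ A)]; rewrite inE ?eqxx //.
  by move/eqP.
have MB j : j < l -> M j \in B j.+1 by move=> jl; rewrite BM ?inE.
have MM j : j.+1 < l -> M j \proper M j.+1.
  by move=> jl; apply: (pB j.+1 j.+2); rewrite ?MB //; lia.
have [f fM] := chain_coloring (fun j jl => proper_sub (MM j jl)).
have cB0 : #|B 0| = r by rewrite cB.
have cBl : #|B l.+1| = s by rewrite cB ?nth_rs ?eqxx.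
have B0 : B 0 \subset down F f.
  apply/subsetP => A AB; rewrite inE (BF 0) // fM //.
  by apply: (pB 0 1) => //; rewrite MB.
have Bl : B l.+1 \subset up F f.
  apply/subsetP => A AB; rewrite inE (BF l.+1) // fM; last by lia.
  by apply: (pB l l.+1) => //; [lia|rewrite -[X in B X](prednK l_gt0) MB //; lia].
exists (f, (B 0, B l.+1)).
  rewrite inE /= cB0 cBl !eqxx B0 Bl !andbT; apply/proper_chainsP; split.
  - by move=> j jl; rewrite fM //; apply: (BF j.+1); rewrite ?MB //; lia.
  - by move=> j jl; rewrite !fM ?MM //; lia.
  - by apply/set0Pn; rewrite -card_gt0 (leq_trans _ (subset_leq_card B0)) ?cB0.
  - by apply/set0Pn; rewrite -card_gt0 (leq_trans _ (subset_leq_card Bl)) ?cBl.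
apply/setP => A; rewrite eG !inE /=; apply/bigcupP/idP => [[[i il] _ /= AB]|].
  case: i il AB => [|i] il AB; first by rewrite AB.
  case: (ltngtP i l) => [il'|?|e]; last by rewrite -e AB orbT.
    move: AB; rewrite BM // inE => /eqP->; rewrite -fM //.
    by apply/orP; left; apply/orP; right; apply/imsetP; exists (Ordinal il').
  by lia.
case/orP => [/orP[AB|/imsetP[j _ ->]]|AB].
- by exists ord0.
- have jl : j.+1 < l.+2 by have := ltn_ord j; lia.
  by exists (Ordinal jl) => //=; rewrite fM ?MB.
- by exists ord_max.
Qed.

Lemma copies_le F : 0 < r -> 0 < s ->
  copies (K_r1s r l s) F <=
  \sum_(f in proper_chains F) 'C(#|down F f|, r) * 'C(#|up F f|, s).
Proof.
move=> r_gt0 s_gt0; rewrite -card_triples; apply: leq_trans (leq_imset_card union_of _).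
apply: subset_leq_card; apply/subsetP => G; rewrite inE => /andP[GF cG].
by have [t tT ->] := copy_triple r_gt0 s_gt0 GF cG; apply: imset_f.
Qed.

Definition onto f := [forall a, fiber f a != set0].

(** Each proper inclusion supplies a point of one color; the extra sets below and above account for
    the two end colors. *)
Lemma proper_chains_onto F f : f \in proper_chains F -> onto f.
Proof.
case/proper_chainsP => _ pf [A +] [A' +]; rewrite !inE.
move=> /andP[_ /properP[_ [x0 x0f _]]] /andP[_ /properP[_ [x1 _ x1f]]].
apply/forallP => a; apply/set0Pn; case: (posnP a) => [a0|a_gt0].
  by exists x0; move: x0f; rewrite !inE leqn0 -val_eqE /= a0.
case: (ltnP a l) => al.
  have /properP[_ [x]] := pf a.-1 ltac:(lia).
  by rewrite !inE => h1 h2; exists x; rewrite inE -val_eqE /=; lia.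
exists x1; move: x1f; rewrite !inE -val_eqE /=.
by have := ltn_ord a; have := ltn_ord (f x1); lia.
Qed.

Lemma up_proper F f A j : A \in up F f -> j < l -> below f j \proper A.
Proof.
rewrite inE => /andP[_ pA] jl; apply: sub_proper_trans pA.
by apply: below_sub; lia.
Qed.

(** * Upper bound for chain-free families *)

Section ChainFree.
Variables (F : {set {set 'I_n}}) (F_free : copies (chain l.+3) F = 0).

(* If [below f j] were properly contained in [below g j], the lower half of the
   first chain followed by the upper half of the second, with one set added at
   each end, would be a chain of [l.+3] members of [F]. *)
Lemma proper_chains_uniq f g p : f \in proper_chains F -> g \in proper_chains F ->
  sorts p f -> sorts p g -> f = g.
Proof.
have no_skip f' g' j : f' \in proper_chains F -> g' \in proper_chains F -> j < l ->
    ~ below f' j \proper below g' j.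
  move=> f'C g'C jl fg.
  have [f'F f'p [A Ad] _] := proper_chainsP _ _ f'C.
  have [g'F g'p _ [A' Au]] := proper_chainsP _ _ g'C.
  (* The index [j] occurs twice, as [below f' j] and then [below g' j], whence the shift by two in
     the second half. *)
  pose h i := if i == 0 then A else if i <= j.+1 then below f' i.-1
              else if i <= l.+1 then below g' i.-2 else A'.
  apply: (@chain_free _ F l.+3 h) => // i il; rewrite /h.
    case: eqP => _; first by move: Ad; rewrite inE => /andP[].
    case: ifP => ?; first by apply: f'F; lia.
    case: ifP => ?; first by apply: g'F; lia.
    by move: Au; rewrite inE => /andP[].
  case: i il => [|[|i]] il /=; first by move: Ad; rewrite inE => /andP[].
    case: ifP => j1; first by apply: f'p; lia.
    have -> : 1 < l.+1 by lia.
    by have -> : 0 = j by lia.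
  case: ifP => i1.
    case: ifP => i2; first by apply: f'p; lia.
    rewrite ifT; last by lia.
    by have -> : i.+1 = j by lia.
  rewrite ifT; last by lia.
  rewrite ifF; last by lia.
  case: ifP => i3; first by apply: g'p; lia.
  by apply: (up_proper Au); lia.
move=> fC gC pf pg; apply: coloring_below_inj => j jl.
have /orP[] := below_total j j pf pg; rewrite subEproper => /orP[/eqP //|].
  by move/no_skip => /(_ fC gC jl).
by move/no_skip => /(_ gC fC jl).
Qed.

(** Two comparable sets below the chain, its [l] members and one set above would form a chain of
    [l.+3] members. *)
Lemma down_antichain f : f \in proper_chains F -> antichain (down F f).
Proof.
move=> fC A A' Ad Ad'; apply/negP => AA'.
have [fF fp _ [C Cu]] := proper_chainsP _ _ fC.
move: Ad Ad'; rewrite !inE => /andP[AF Af] /andP[AF' Af'].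
pose h i := if i == 0 then A else if i == 1 then A' else
            if i <= l.+1 then below f i.-2 else C.
apply: (@chain_free _ F l.+3 h) => // -[|[|i]] il; rewrite /h //=.
  case: ifP => ?; first by apply: fF; lia.
  by move: Cu; rewrite inE => /andP[].
  by rewrite ifT; last by lia.
rewrite ifT; last by lia.
case: ifP => i2; first by apply: fp; lia.
by apply: (up_proper Cu); lia.
Qed.

Lemma up_antichain f : f \in proper_chains F -> antichain (up F f).
Proof.
move=> fC A A' Au Au'; apply/negP => AA'.
have [fF fp [C Cd] _] := proper_chainsP _ _ fC.
pose h i := if i == 0 then C else if i <= l then below f i.-1 else
            if i == l.+1 then A else A'.
have := Cd; rewrite inE => /andP[CF Cf].
have := Au; rewrite inE => /andP[AF _].
have := Au'; rewrite inE => /andP[AF' _].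
apply: (@chain_free _ F l.+3 h) => // -[|i] il; rewrite /h //=.
- case: ifP => ?; first by apply: fF; lia.
  by case: ifP.
- by rewrite l_gt0.
case: ifP => i1.
  case: ifP => i2; first by apply: fp; lia.
  rewrite ifT; last by lia.
  by apply: (up_proper Au); lia.
have -> : i = l by lia.
by rewrite eqxx !ifF //; lia.
Qed.

(* The number of copies in the family of complete levels determined by the fiber
   sizes of [f], the outer two levels being placed optimally. *)
Definition weight f :=
  type_count f * ('C(central #|fiber f ord0|, r) * 'C(central #|fiber f ord_max|, s)).

(** [LYM] weighs each extendable chain by its numbers of choices below and above, which Sperner's
    theorem bounds in terms of the two end fibers. *)
Lemma copies_le_weight b : 0 < r -> 0 < s ->
  (forall f, onto f -> weight f <= b) ->
  copies (K_r1s r l s) F <= b.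
Proof.
move=> r_gt0 s_gt0 wb; apply: leq_trans (copies_le F r_gt0 s_gt0) _; apply: LYM => [|f fC].
  exact: proper_chains_uniq.
apply: leq_trans (wb f (proper_chains_onto fC)).
rewrite leq_mul2l; apply/orP; right; apply: leq_mul; apply: leq_bin2l.
  rewrite -below0; apply: Sperner_sub (down_antichain fC) _ => A.
  by rewrite inE => /andP[_ /proper_sub].
have -> : fiber f ord_max = ~: below f l.-1.
  by apply/setP => x; rewrite !inE -val_eqE /=; have := ltn_ord (f x); lia.
apply: Sperner_sup (up_antichain fC) _ => A.
by rewrite inE => /andP[_ /proper_sub].
Qed.

End ChainFree.

(** * Lower bound from complete levels *)

Section Layers.
(** Levels are numbered from 1 and level 1 lies below the chain, so [below f j] belongs to level
    [j.+2]. *)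
Variables (f : coloring n l) (sz : nat -> nat).
Hypotheses (sz_incr : forall j, 0 < j < l.+2 -> sz j < sz j.+1)
           (sz_le : sz l.+2 <= n)
           (sz_below : forall j, j < l -> sz j.+2 = #|below f j|).

Let F := \bigcup_(1 <= j < l.+3) layer n (sz j).

Lemma mem_layers (A : {set 'I_n}) j : 0 < j < l.+3 -> #|A| = sz j -> A \in F.
Proof.
move=> jl Aj; rewrite /F big_geq_mkord /=.
have jl' : j < l.+3 by lia.
apply/bigcupP; exists (Ordinal jl') => /=; first by lia.
by rewrite inE Aj.
Qed.

Lemma sz_lt j k : 0 < j -> j < k -> k < l.+3 -> sz j < sz k.
Proof.
move=> j0; elim: k => // k IH; rewrite ltnS leq_eqVlt => /orP[/eqP e kl|jk kl].
  by rewrite e; apply: sz_incr; lia.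
by apply: ltn_trans (IH jk _) (sz_incr _); lia.
Qed.

Lemma sz_inj j k : 0 < j < l.+3 -> 0 < k < l.+3 -> sz j = sz k -> j = k.
Proof.
move=> jl kl e; case: (ltngtP j k) => // jk.
  by have := sz_lt (j := j) (k := k); lia.
by have := sz_lt (j := k) (k := j); lia.
Qed.

Let C : {set coloring n l} := [set g | same_type f g].
Let D g := [set A : {set 'I_n} | A \subset below g 0 & #|A| == sz 1].
Let U g := [set A : {set 'I_n} | below g l.-1 \subset A & #|A| == sz l.+2].

Lemma card_U g : g \in C -> #|U g| = 'C(#|fiber f ord_max|, n - sz l.+2).
Proof.
rewrite inE => fg.
have cg : #|fiber f ord_max| = #|~: below g l.-1|.
  rewrite (same_typeP _ _ fg); apply: eq_card => x.
  by rewrite !inE -val_eqE /=; have := ltn_ord (g x); lia.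
rewrite cg -cards_draws -[RHS](card_imset _ (@setC_inj _)); apply: eq_card => A.
apply/idP/imsetP => [|[A']].
  rewrite inE => /andP[sA /eqP cA]; exists (~: A); rewrite ?setCK // inE setCS sA /=.
  by rewrite cardsCs setCK card_ord cA.
rewrite !inE => /andP[sA /eqP cA] ->; rewrite -subsetC sA //=.
by rewrite cardsCs setCK card_ord cA; lia.
Qed.

Lemma members_sz g A : g \in C -> A \in members g ->
  exists2 j, j < l & #|A| = sz j.+2 /\ A = below g j.
Proof.
rewrite inE => fg /imsetP[j _ ->]; exists (j : nat) => //.
by rewrite sz_below // (below_same _ fg).
Qed.

Lemma triples_sz t A : t \in triples C D U -> A \in union_of t ->
  exists2 j, 0 < j < l.+3 & #|A| = sz j.
Proof.
case: t => g [R S]; rewrite inE /= => /andP[gC /andP[/andP[/subsetP RD _] /andP[/subsetP SU _]]].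
rewrite !inE /= => /orP[/orP[/RD|/(members_sz gC)]|/SU]; rewrite ?inE.
- by case/andP => _ /eqP ->; exists 1.
- by case=> j jl [-> _]; exists j.+2 => //; lia.
- by case/andP => _ /eqP ->; exists l.+2 => //; lia.
Qed.

Lemma union_of_copy t : t \in triples C D U ->
  (union_of t \subset F) && is_copy (K_r1s r l s) (union_of t).
Proof.
move=> tT; apply/andP; split.
  by apply/subsetP => A /(triples_sz tT)[j jl Aj]; apply: mem_layers Aj.
case: t tT => g [R S]; rewrite inE /=.
move=> /andP[gC /andP[/andP[/subsetP RD /eqP cR] /andP[/subsetP SU /eqP cS]]].
pose B i := if i == 0 then R else if i == l.+1 then S else [set below g i.-1].
have cB i A : i < l.+2 -> A \in B i -> #|A| = sz i.+1.
  rewrite /B => il; case: eqP => [->|/eqP i0].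
    by move/RD; rewrite inE => /andP[_ /eqP].
  case: eqP => [->|/eqP i1]; first by move/SU; rewrite inE => /andP[_ /eqP].
  rewrite inE => /eqP->; have -> : i = i.-1.+1 by lia.
  by rewrite sz_below; [move: gC; rewrite inE => /below_same ->|lia].
have lowB i A : i < l.+1 -> A \in B i -> A \subset below g i.-1.
  rewrite /B => il; case: eqP => [->|_]; first by move/RD; rewrite inE => /andP[].
  by rewrite ltn_eqF // inE => /eqP->.
(* The minimum handles the top block [i = l.+1], whose sets contain only the last chain member
   [below g l.-1]. *)
have upB i A : 0 < i < l.+2 -> A \in B i -> below g (minn i.-1 l.-1) \subset A.
  rewrite /B => il; rewrite ifF; last by lia.
  case: eqP => [->|il'].
    by move/SU; rewrite inE => /andP[+ _]; apply: subset_trans; apply: below_sub; lia.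
  by rewrite inE => /eqP->; apply: below_sub; lia.
apply: (@blocks_copy _ _ B); rewrite /blocks size_rs; split.
- move=> i il; rewrite nth_rs // /B; case: eqP => // _; case: eqP => // _.
  by rewrite cards1.
- move=> i j A A' ij Ai Aj.
  rewrite properEcard (cB i) ?(cB j) // ?sz_lt //; try lia.
  rewrite andbT; apply: subset_trans (lowB i A _ Ai) _; first by lia.
  by apply: subset_trans (upB j A' _ Aj); [apply: below_sub|]; lia.
apply/setP => A; rewrite !inE /=; apply/idP/bigcupP => [|[[i il] _ /=]].
  case/orP => [/orP[AR|/imsetP[j _ ->]]|AS].
  - by exists ord0.
  - have jl : j.+1 < l.+2 by have := ltn_ord j; lia.
    exists (Ordinal jl) => //; rewrite /B /= eqSS ltn_eqF ?inE //.
  - by exists ord_max => //; rewrite /B /= eqxx.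
rewrite /B; case: eqP => [_ ->//|/eqP i0]; case: eqP => [_ ->|/eqP i1]; first by rewrite orbT.
rewrite inE => /eqP->; apply/orP; left; apply/orP; right; apply/imsetP.
by have il' : i.-1 < l by [lia]; exists (Ordinal il').
Qed.

(** The levels have distinct sizes, so the size of a member tells which part of the triple it comes
    from. *)
Lemma union_of_inj : {in triples C D U &, injective union_of}.
Proof.
have levels t A : t \in triples C D U -> A \in union_of t ->
    [/\ #|A| = sz 1 -> A \in t.2.1, #|A| = sz l.+2 -> A \in t.2.2
      & forall j, j < l -> #|A| = sz j.+2 -> A = below t.1 j].
  case: t => g [R S]; rewrite inE /=.
  move=> /andP[gC /andP[/andP[/subsetP RD _] /andP[/subsetP SU _]]].
  rewrite !inE /= => /orP[/orP[AR|/(members_sz gC)[j jl [Aj eA]]]|AS].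
  - have := RD A AR; rewrite inE => /andP[_ /eqP->].
    by split=> // [|j jl] /sz_inj e; have := e ltac:(lia) ltac:(lia); lia.
  - rewrite Aj; split=> [||k kl] /sz_inj e; have := e ltac:(lia) ltac:(lia); try lia.
    by case=> <-.
  - have := SU A AS; rewrite inE => /andP[_ /eqP->].
    by split=> // [|j jl] /sz_inj e; have := e ltac:(lia) ltac:(lia); lia.
have half t t' : t \in triples C D U -> t' \in triples C D U ->
    union_of t = union_of t' ->
    [/\ t.2.1 \subset t'.2.1, t.2.2 \subset t'.2.2 &
        forall j, j < l -> below t.1 j = below t'.1 j].
  move=> tT t'T e.
  move: (tT); rewrite inE.
  move=> /andP[tC /andP[/andP[/subsetP tD _] /andP[/subsetP tU _]]].
  split.
  - apply/subsetP => A At; have [|h _ _] := levels t' A t'T; first by rewrite -e !inE At.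
    by apply: h; have := tD A At; rewrite inE => /andP[_ /eqP].
  - apply/subsetP => A At; have [|_ h _] := levels t' A t'T; first by rewrite -e !inE At orbT.
    by apply: h; have := tU A At; rewrite inE => /andP[_ /eqP].
  move=> j jl; have [|_ _ h] := levels t' (below t.1 j) t'T.
    rewrite -e !inE; apply/orP; left; apply/orP; right; apply/imsetP.
    by exists (Ordinal jl).
  by apply: h; rewrite // sz_below //; move: tC; rewrite inE => /below_same ->.
move=> t t' tT t'T e; have [h1 h2 h3] := half t t' tT t'T e.
have [h1' h2' _] := half t' t t'T tT (esym e).
case: t t' h1 h2 h3 h1' h2' {tT t'T e} => [g [R S]] [g' [R' S']] /= h1 h2 h3 h1' h2'.
congr (_, (_, _)); first exact: coloring_below_inj.
  by apply/eqP; rewrite eqEsubset h1.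
by apply/eqP; rewrite eqEsubset h2.
Qed.

(** All colorings of the type of [f] give equally many triples, and distinct triples give distinct
    copies. *)
Lemma copies_layers_ge :
  type_count f * ('C('C(#|fiber f ord0|, sz 1), r) *
                  'C('C(#|fiber f ord_max|, n - sz l.+2), s))
  <= copies (K_r1s r l s) F.
Proof.
have -> : type_count f * ('C('C(#|fiber f ord0|, sz 1), r) *
            'C('C(#|fiber f ord_max|, n - sz l.+2), s)) = #|triples C D U|.
  rewrite card_triples -sum_nat_const; apply: eq_bigr => g gC.
  by rewrite card_U // cards_draws -below0; move: gC; rewrite inE => /below_same ->.
rewrite -(card_in_imset union_of_inj); apply: subset_leq_card.
by apply/subsetP => _ /imsetP[t tT ->]; rewrite inE union_of_copy.
Qed.

End Layers.
End Copies.

(** * Growth of the number of choices at the bottom *)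

(** Falling factorials are compared factor by factor: [E - j <= 2 * r * (D - j)] for [j < r]. *)
Lemma bin_double r D E : 0 < r -> r <= D -> E <= 2 * D ->
  'C(E, r) <= (2 * r) ^ r * 'C(D, r).
Proof.
move=> r0 rD ED; rewrite -(leq_pmul2r (fact_gt0 r)) -mulnA !bin_ffact.
suff H j : j <= r -> E ^_ j <= (2 * r) ^ j * D ^_ j by apply: H.
elim: j => // j IH jr; rewrite !ffactnSr expnSr mulnACA.
by apply: leq_mul (IH (ltnW jr)) _; nia.
Qed.

(** The central coefficient at most doubles, so the loss is bounded by a constant, which [m.+1]
    exceeds. *)
Lemma bin_central_growth r m : 0 < r -> r + (2 * r) ^ r <= m ->
  'C(central m.+1, r) <= m.+1 * 'C(central m, r).
Proof.
move=> r0 mr; apply: leq_trans (bin_double r0 (_ : r <= central m) (centralS m)) _.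
  by apply: leq_trans (central_ge m); lia.
by rewrite leq_mul2r; apply/orP; right; lia.
Qed.

Lemma max_La_attained n d d' (P : finPOrderType d) (Q : finPOrderType d')
    (F : {set {set 'I_n}}) :
  copies P F = 0 ->
  (forall F' : {set {set 'I_n}}, copies P F' = 0 -> copies Q F' <= copies Q F) ->
  La_attained P Q F.
Proof.
move=> F0 maxF; split=> //; apply/eqP; rewrite eqn_leq; apply/andP; split.
  by apply: (leq_bigmax_cond (F := fun F => copies Q F)); rewrite F0.
by apply/bigmax_leqP => F' /eqP; apply: maxF.
Qed.

(** * Colorings of maximum weight *)

Section Optimum.
Variables n l r s : nat.
Implicit Types f g : coloring n l.

(** Positivity lets common factors be cancelled; if no onto coloring has positive weight, chain-free
    families contain no copy at all. *)
Definition optimal f :=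
  [/\ onto f, 0 < weight r s f & forall g, onto g -> weight r s g <= weight r s f].

Lemma onto_gt0 f a : onto f -> 0 < #|fiber f a|.
Proof. by move/forallP/(_ a); rewrite card_gt0. Qed.

Lemma onto_recolor f x a b : onto f -> f x = a -> a != b -> 1 < #|fiber f a| ->
  onto (recolor f x b).
Proof.
move=> of_ fx ab fa; apply/forallP => c; rewrite -card_gt0.
have := fiber_recolor c fx ab; have := onto_gt0 c of_.
by case: (eqVneq c a) => [->|_]; lia.
Qed.

(** Moving a point from fiber [a] to fiber [b] keeps the end factors and multiplies the number of
    chains by [#|fiber f a| / #|fiber f b|.+1], which cannot exceed 1. *)
Lemma optimal_balanced f a b : optimal f ->
  a \notin [:: ord0; ord_max] -> b \notin [:: ord0; ord_max] ->
  #|fiber f a| <= #|fiber f b|.+1.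
Proof.
case=> of_ wf maxf; rewrite !inE !negb_or => /andP[a0 al] /andP[b0 bl].
rewrite leqNgt; apply/negP => ba; have ab : a != b by apply: contraL ba => /eqP->; lia.
have /card_gt0P[x] : 0 < #|fiber f a| by lia.
rewrite inE => /eqP fx.
have e := type_count_recolor fx ab.
have fb := fiber_recolor b fx ab; rewrite eqxx eq_sym (negbTE ab) in fb.
have := maxf _ (onto_recolor of_ fx ab ltac:(lia)); rewrite /weight.
have f0 := fiber_recolor ord0 fx ab.
rewrite !(eq_sym ord0) (negbTE a0) (negbTE b0) !addn0 in f0.
have fl := fiber_recolor ord_max fx ab.
rewrite !(eq_sym ord_max) (negbTE al) (negbTE bl) !addn0 in fl.
rewrite f0 fl; move: wf; rewrite /weight muln_gt0 => /andP[N0 K0].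
rewrite leq_pmul2r // => gf; nia.
Qed.

(* Below this bound, and only when [s = 1], every optimum may have its top level
   equal to [{[n]}], directly above a level of sets of size [n.-1]. *)
Definition top_threshold := if 1 < s then 0 else l + (r + (2 * r) ^ r).+2.

Lemma fiber_recolor_add f x a b : f x = a -> a != b ->
  #|fiber (recolor f x b) b| = #|fiber f b|.+1.
Proof.
by move=> fx ab; have := fiber_recolor b fx ab; rewrite eqxx eq_sym (negbTE ab); lia.
Qed.

Lemma fiber_recolor_rem f x a b : f x = a -> a != b ->
  #|fiber f a| = #|fiber (recolor f x b) a|.+1.
Proof.
by move=> fx ab; have := fiber_recolor a fx ab; rewrite eqxx (negbTE ab); lia.
Qed.

Lemma card_fibers f : n = \sum_a #|fiber f a|.
Proof.
rewrite -[LHS]card_ord -sum1_card (partition_big f predT) //=.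
by apply: eq_bigr => a _; rewrite -sum1_card; apply: eq_bigl => x; rewrite inE.
Qed.

Lemma optimal_weight_ge f g : optimal f -> onto g -> weight r s f <= weight r s g ->
  optimal g.
Proof.
case=> _ wf maxf og fg; split=> // [|h oh]; first exact: leq_trans fg.
by apply: leq_trans fg; apply: maxf.
Qed.

(* If [s = 1] and the last fiber is a singleton, moving one element into it from a
   fiber of size [a] multiplies the number of chains by [a / 2] and doubles the
   number of top sets; from fiber 0 it also costs at most a factor [(2 * r) ^ r]
   in the choice of the bottom sets. *)
Lemma optimal_top f : 0 < l -> 0 < r -> 0 < s -> optimal f ->
  exists2 g, optimal g &
    1 < #|fiber g ord_max| \/ (#|fiber g ord_max| = 1 /\ n < top_threshold).
Proof.
move=> l_gt0 r_gt0 s_gt0 opt; have [of_ wf maxf] := opt.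
have := onto_gt0 ord_max of_.
case: (ltnP 1 #|fiber f ord_max|) => [|l1] l0; first by exists f => //; left.
have {l0 l1} l1 : #|fiber f ord_max| = 1 by lia.
case: (ltnP n top_threshold) => [|n_ge]; first by exists f => //; right.
(* [central 1] is 1, so a larger [s] would make the weight vanish. *)
have s1 : s = 1.
  have : 0 < 'C(central 1, s) by move: wf; rewrite /weight l1 !muln_gt0 => /and3P[].
  by rewrite bin_gt0; have : central 1 = 1 by []; lia.
have c1 : central 1 = 1 by []. have c2 : central 2 = 2 by [].
have ol : ord0 != ord_max :> 'I_l.+1 by rewrite -val_eqE /=; lia.
case: (pickP (fun a : 'I_l.+1 => (a \notin [:: ord0; ord_max]) && (1 < #|fiber f a|))).
  move=> a /andP[]; rewrite !inE negb_or => /andP[a0 al] fa.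
  have /card_gt0P[x] : 0 < #|fiber f a| by lia.
  rewrite inE => /eqP fx.
  have e := type_count_recolor fx al.
  have el := fiber_recolor_add fx al.
  have e0 := fiber_recolor ord0 fx al.
  rewrite !(eq_sym ord0) (negbTE a0) (eq_sym _ ord0) (negbTE ol) !addn0 in e0.
  exists (recolor f x ord_max); last by left; rewrite el l1.
  apply: (optimal_weight_ge opt); first exact: onto_recolor fx al fa.
  rewrite el l1 in e; rewrite /weight e0 el l1 s1 c1 c2 !bin1 muln1 (mulnC _ 2) mulnA -e.
  by rewrite leq_mul2r leq_pmulr ?orbT //; lia.
move=> small.
(* All other fibers are singletons now, so fiber 0 is large by the threshold and can give up a
   point. *)
have n_eq : n = #|fiber f ord0| + l.
  rewrite [LHS](card_fibers f) (bigD1 ord0) //=; congr (_ + _).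
  rewrite (eq_bigr (fun=> 1)) => [|a a0].
    by rewrite sum1_card cardC1 card_ord.
  case: (eqVneq a ord_max) => [->//|al].
  have := small a; rewrite !inE negb_or a0 al /=.
  by move: (onto_gt0 a of_); case: #|_| => [|[]].
have n0_ge : (r + (2 * r) ^ r).+2 <= #|fiber f ord0|.
  move: n_ge n_eq; rewrite /top_threshold s1 /=.
  by move: (#|fiber f ord0|) ((2 * r) ^ r) => c p; lia.
have /card_gt0P[x] : 0 < #|fiber f ord0| by lia.
rewrite inE => /eqP fx.
have e := type_count_recolor fx ol.
have el := fiber_recolor_add fx ol.
have e0 := fiber_recolor_rem fx ol.
exists (recolor f x ord_max); last by left; rewrite el l1.
apply: (optimal_weight_ge opt); first by apply: onto_recolor of_ fx ol _; lia.
have growth := @bin_central_growth r #|fiber (recolor f x ord_max) ord0| r_gt0 ltac:(lia).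
rewrite -e0 in growth.
rewrite /weight el l1 s1 c1 c2 !bin1 muln1.
rewrite el l1 in e.
apply: leq_trans (leq_mul (leqnn _) growth) _.
by rewrite mulnA e -!mulnA; apply: leq_mul => //; rewrite mulnC.
Qed.

Lemma optimal_ex : (exists f, optimal f) \/ (forall f, onto f -> weight r s f <= 0).
Proof.
case: (pickP (fun f => onto f && (0 < weight r s f))) => [f0 /andP[of0 wf0]|none]; last first.
  by right=> f of_; rewrite leqNgt; have := none f; rewrite of_ => /= ->.
left; case: (arg_maxnP (weight r s) of0) => f of_ maxf.
by exists f; split=> //; apply: leq_trans wf0 _; apply: maxf.
Qed.

End Optimum.

(** The second alternative for the top level covers [i l.+1 = n.-1] with [n > 0], where
    [(n + n.-1) %/ 2] would repeat the level [n.-1]. *)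
Theorem theorem1p13 (l r s : nat) (hl : 0 < l) (hr : 0 < r) (hs : 0 < s) :
  exists2 n0 : nat, (1 < s -> n0 = 0) &
  forall n : nat, exists i : nat -> nat,
    [/\ (forall j, 1 <= j <= l.+1 -> i j <= i j.+1) /\ i l.+2 <= n,
        i 1 = i 2 %/ 2,
        i l.+2 = (n + i l.+1) %/ 2
          \/ [/\ n < n0, i l.+1 = n.-1 & i l.+2 = n],
        (forall j k, 2 <= j <= l -> 2 <= k <= l ->
           i j.+1 - i j <= (i k.+1 - i k).+1)
      & La_attained (chain l.+3) (K_r1s r l s)
          (\bigcup_(1 <= j < l.+3) layer n (i j))].
Proof.
exists (top_threshold l r s) => [s1|n]; first by rewrite /top_threshold s1.
case: (optimal_ex n l r s) => [[f0 opt0]|w0]; last first.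
  (* Here the maximum is 0, so any levels with the required arithmetic will do. *)
  exists (fun j => if j == l.+2 then n %/ 2 else 0); rewrite eqxx /=; split.
  - by split=> [j jl|]; [rewrite ifF //; lia|lia].
  - by rewrite !ifF //; lia.
  - by left; rewrite ifF ?addn0 //; lia.
  - by move=> j k jl kl; rewrite ifF //; lia.
  apply: max_La_attained => [|F' F'0]; first exact: layers_chain_free.
  by apply: leq_trans (copies_le_weight hl F'0 hr hs w0) _.
have [f opt top] := optimal_top hl hr hs opt0.
have [of_ wf maxf] := opt.
(* With a singleton last fiber the midpoint would round down to the level below, so the top level is
   [n]. *)
pose t := if 1 < #|fiber f ord_max| then (n + #|below f l.-1|) %/ 2 else n.
pose i j := if j == 1 then #|below f 0| %/ 2 else if j == l.+2 then t
            else #|below f j.-2|.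
have n_eq : n = #|below f l.-1| + #|fiber f ord_max|.
  by apply: (@card_below _ _ f ord_max); rewrite ?prednK.
have fl0 := onto_gt0 ord_max of_.
have i1 : i 1 = #|below f 0| %/ 2 by [].
have il : i l.+2 = t by rewrite /i eqxx.
have ib j : j < l -> i j.+2 = #|below f j| by move=> jl; rewrite /i /= ifF //; lia.
have tn : t <= n by rewrite /t; case: ifP => _; lia.
have step j : 2 <= j <= l -> exists a : 'I_l.+1,
    [/\ a \notin [:: ord0; ord_max] & i j.+1 = i j + #|fiber f a|].
  case: j => [|[|j]] // jl; have aP : j.+1 < l.+1 by lia.
  exists (Ordinal aP); split; first by rewrite !inE -!val_eqE /=; lia.
  by rewrite !ib; [apply: below_fiber|lia|lia].
have incr j : 0 < j < l.+2 -> i j < i j.+1.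
  move=> jl; case: (ltnP j 2) => j2.
    have -> : j = 1 by lia.
    by rewrite i1 ib // below0; have := onto_gt0 ord0 of_; lia.
  case: (ltnP l j) => jl'; last first.
    have [|a [_ ->]] := step j; first by lia.
    by have := onto_gt0 a of_; lia.
  have -> : j = l.-1.+2 by lia.
  rewrite ib ?prednK // il /t.
  by case: ifP => ?; lia.
exists i; split.
- by split=> [j jl|]; [apply/ltnW/incr; lia|rewrite il].
- by rewrite i1 ib.
- have -> : i l.+1 = #|below f l.-1| by rewrite -[in l.+1](prednK hl) ib //; lia.
  rewrite il /t; case: top => [->|[e1 n_lt]]; first by left.
  by right; rewrite e1; split=> //; move: n_eq; rewrite e1; move: #|_| => c; lia.
- move=> j k /step[a [aN ->]] /step[b [bN ->]].
  by rewrite !addKn; apply: optimal_balanced opt _ _.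
apply: max_La_attained => [|F' F'0]; first exact: layers_chain_free.
apply: leq_trans (copies_le_weight hl F'0 hr hs maxf) _.
apply: leq_trans (copies_layers_ge r s hl incr _ ib); last by rewrite il.
rewrite i1 il below0 /weight -/(central _); apply: leq_mul => //; apply: leq_mul => //.
apply: leq_bin2l; rewrite /t; case: top => [t1|[e1 _]]; last by rewrite e1 /= subnn.
(* The complement of a top set has the upper half of the last fiber size; symmetry of binomials
   turns it into the lower half used in [central]. *)
rewrite t1 -bin_sub; last by lia.
have -> // : #|fiber f ord_max| - (n - (n + #|below f l.-1|) %/ 2) =
  #|fiber f ord_max| %/ 2 by lia.
Qed.
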